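(* Let $C=\sum_{j=1}^m\alpha_jP_{(x_j,z_j)}\in\mathbb{R}^{2^n\times2^n}$ be a Pauli-sparse symmetric matrix with real coefficients $\alpha_j$, let $\rho$ be a quantum state on $n$ qubits, and let $U$ be a random orthogonal matrix drawn from an ensemble distributed according to a probability measure $\mu$ on orthogonal $2^n\times2^n$ matrices. Let $E(\rho)$ be the worst-case cost of computing $\langle i|\sqrt{\rho}\,U|0\rangle$ up to constant relative precision for any computational basis state $|i\rangle$, and let $|x\rangle=\operatorname{sign}(\sqrt{\rho}\,U|0\rangle)\in\{\pm1\}^{2^n}$ (sign applied entrywise). Then for every $\epsilon>0$ one can estimate the energy density $2^{-n}\langle x|C|x\rangle$ up to additive error $\epsilon$, with probability of success at least $2/3$, in time $$\mathcal{O}\bigl(\epsilon^{-2}\,m\,E(\rho)\,\|\alpha\|_{\ell_1}^2\bigr).$$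
   Context: For $(x,z)\in\{0,1\}^{2n}$ let $P_{(x,z)}=\bigotimes_{j=1}^n i^{x_jz_j}X^{x_j}Z^{z_j}$ be the Pauli string, where $X,Z$ are the $2\times 2$ Pauli matrices. A matrix is Pauli-sparse if it is a linear combination of $m=\mathrm{poly}(n)$ Pauli strings; it is given as the list of strings and coefficients. $\|\alpha\|_{\ell_1}=\sum_{j=1}^m|\alpha_j|$. A quantum state is a positive semidefinite matrix of trace one (here real symmetric, of size $2^n\times2^n$), and $\sqrt{\rho}$ is its positive semidefinite square root. ''Constant relative precision'' means with relative error bounded by a constant smaller than $1$, so that the sign of the entry is determined; $\operatorname{sign}(0)$ is assigned a fixed value in $\{\pm1\}$. The matrix $U$ is drawn once and then fixed; the success probability is over the algorithm's internal sampling. The elementary cost of sampling a uniformly random index and applying a Pauli string to a basis state is dominated by $E(\rho)$. *)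

(* Defs.v *)
From HB Require Import structures.
From mathcomp Require Import all_boot all_order all_algebra.
From mathcomp Require Import complex mxtens.
From mathcomp Require Import all_classical all_reals all_analysis.

Set Implicit Arguments.
Unset Strict Implicit.
Unset Printing Implicit Defensive.

Import Order.TTheory GRing.Theory Num.Theory.

Local Open Scope classical_set_scope.
Local Open Scope ring_scope.

Section Pauli.
Variable R : realType.

Definition pauliX : 'M[R[i]]_2 := \matrix_(a, b) (a != b)%:R.

Definition pauliZ : 'M[R[i]]_2 := \matrix_(a, b) ((-1) ^+ a *+ (a == b)).

Fixpoint tensor_prod (n : nat) : ('I_n -> 'M[R[i]]_2) -> 'M[R[i]]_(2 ^ n) :=
  match n with
  | 0 => fun=> 1%:M
  | k.+1 => fun F =>
      castmx (esym (expnS 2 k), esym (expnS 2 k))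
             (F ord0 *t tensor_prod (fun j : 'I_k => F (lift ord0 j)))
  end.

(* The pair (x, z), i.e. an element of {0,1}^(2n). *)
Definition pstring (n : nat) : Type :=
  ({ffun 'I_n -> bool} * {ffun 'I_n -> bool})%type.

Definition pauli (n : nat) (p : pstring n) : 'M[R[i]]_(2 ^ n) :=
  tensor_prod (fun j =>
    'i%C ^+ (p.1 j * p.2 j) *: (pauliX ^+ p.1 j *m pauliZ ^+ p.2 j)).

(* A Pauli string maps the basis state b to a phase times a single basis state:
   the unique a with <a|P|b> != 0 (the default value b is never used), the
   phase being <a|P|b>. *)
Definition pauli_target (n : nat) (p : pstring n) (b : 'I_(2 ^ n))
    : 'I_(2 ^ n) :=
  odflt b [pick a | pauli p a b != 0].

Definition pauli_phase (n : nat) (p : pstring n) (b : 'I_(2 ^ n)) : R[i] :=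
  pauli p (pauli_target p b) b.

End Pauli.

Definition poly_bounded (m : nat -> nat) : Prop :=
  exists c k : nat, forall n, (m n <= c * n.+1 ^ k)%N.

Section States.
Variable R : realType.

Definition psd (N : nat) (A : 'M[R]_N) : Prop :=
  A \is symmetricmx /\ forall v : 'cV[R]_N, 0 <= (v^T *m A *m v) 0 0.

Definition quantum_state (n : nat) (rho : 'M[R]_(2 ^ n)) : Prop :=
  psd rho /\ \tr rho = 1.

Definition psd_sqrt (N : nat) (S A : 'M[R]_N) : Prop :=
  psd S /\ S *m S = A.

Definition orthogonal_mx (N : nat) (Q : 'M[R]_N) : Prop :=
  Q *m Q^T = 1%:M.

Lemma pow2_gt0 n : (0 < 2 ^ n)%N. Proof. by rewrite expn_gt0. Qed.

Definition idx0 (n : nat) : 'I_(2 ^ n) := Ordinal (pow2_gt0 n).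

Definition ket0 (n : nat) : 'cV[R]_(2 ^ n) := delta_mx (idx0 n) 0.

(* The bit s fixes the convention sign(0) = (-1)^s. *)
Definition sign_at (s : bool) (v : R) : R :=
  if v == 0 then (-1) ^+ s else Num.sg v.

Definition sign_vec (s : bool) (N : nat) (v : 'cV[R]_N) : 'cV[R]_N :=
  map_mx (sign_at s) v.

Definition energy_density (n : nat) (C : 'M[R]_(2 ^ n)) (x : 'cV[R]_(2 ^ n))
    : R :=
  (2 ^+ n)^-1 * (x^T *m C *m x) 0 0.

Definition l1norm (m : nat) (alpha : 'I_m -> R) : R := \sum_j `|alpha j|.

Definition random_orthogonal d (T : measurableType d) (N : nat)
    (U : T -> 'M[R]_N) : Prop :=
  (forall i j, measurable_fun setT (fun w => U w i j)) /\
  (forall w, orthogonal_mx (U w)).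

End States.

(* PTerms, PNorm and PEps stand for m, |alpha|_1 and epsilon. *)
Inductive pexpr : Type :=
| PNat of nat
| PTerms
| PNorm
| PEps
| PAdd of pexpr & pexpr
| PMul of pexpr & pexpr
| PDiv of pexpr & pexpr.

Inductive arith : Type := Add | Sub | Mul | Div.

(* Programs of a randomized real-number machine with three banks of registers:
   loop counters (nat), basis-state indices, and reals.  A program is a finite
   text mentioning neither n, m nor any datum of the problem.
     Draw i         index i := uniformly random basis state
     Pauli k i i' r r'
                    apply the Pauli string numbered by counter k to the basis
                    state in i: index i' := the resulting basis state,
                    (r, r') := (real, imaginary) part of the phase
     Coef k r       r := the coefficient numbered by counter k
     Entry i r      r := the value returned by the entry evaluator on index i
     For k e c      run c with counter k = 0, 1, ..., floor(e) - 1 *)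
Inductive prog : Type :=
| Draw of nat
| Pauli of nat & nat & nat & nat & nat
| Coef of nat & nat
| Entry of nat & nat
| Param of nat & pexpr
| Sign of nat & nat
| Arith of arith & nat & nat & nat
| Seq of prog & prog
| For of nat & pexpr & prog.

Section Machine.
Variable R : realType.

Record problem (n m : nat) := Problem {
  coefs : 'I_m -> R;
  strings : 'I_m -> pstring n;
  precision : R;
  sign0 : bool }.

(* Black-box access to a vector: programs can only learn entry_value i by
   executing Entry, which adds entry_cost i to the clock. *)
Record evaluator (n : nat) := Evaluator {
  entry_value : 'I_(2 ^ n) -> R;
  entry_cost : 'I_(2 ^ n) -> R }.

Record state (n : nat) := State {
  cnt : nat -> nat;
  idx : nat -> 'I_(2 ^ n);
  reg : nat -> R;
  clock : R }.

(* Finitely supported distributions, as lists of weighted outcomes. *)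
Definition dist (A : Type) : Type := seq (R * A).

Definition dret (A : Type) (a : A) : dist A := [:: (1, a)].

Definition dbind (A B : Type) (d : dist A) (f : A -> dist B) : dist B :=
  [seq (wa.1 * wb.1, wb.2) | wa <- d, wb <- f wa.2].

Definition dunif (n : nat) : dist 'I_(2 ^ n) :=
  [seq ((2 ^+ n)^-1, i) | i <- enum 'I_(2 ^ n)].

Definition prob (A : Type) (d : dist A) (E : A -> bool) : R :=
  \sum_(wa <- d | E wa.2) wa.1.

Definition surely (A : Type) (d : dist A) (E : A -> bool) : bool :=
  all (fun wa => E wa.2) d.

Definition upd (A : Type) (f : nat -> A) (k : nat) (a : A) : nat -> A :=
  fun j => if j == k then a else f j.

Definition set_cnt n (s : state n) k t :=
  State (upd (cnt s) k t) (idx s) (reg s) (clock s).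
Definition set_idx n (s : state n) k i :=
  State (cnt s) (upd (idx s) k i) (reg s) (clock s).
Definition set_reg n (s : state n) k v :=
  State (cnt s) (idx s) (upd (reg s) k v) (clock s).
Definition tick n (t : R) (s : state n) :=
  State (cnt s) (idx s) (reg s) (clock s + t).

Definition init_state n : state n :=
  State (fun=> 0%N) (fun=> idx0 n) (fun=> 0) 0.

Definition arith_eval (o : arith) (u v : R) : R :=
  match o with Add => u + v | Sub => u - v | Mul => u * v | Div => u / v end.

Section Run.
Variables (n m : nat) (pb : problem n m) (ev : evaluator n).
(* cost of one elementary operation *)
Variable tau : R.

Fixpoint pexpr_eval (e : pexpr) : R :=
  match e with
  | PNat k => k%:R
  | PTerms => m%:R
  | PNorm => l1norm (coefs pb)
  | PEps => precision pb
  | PAdd e1 e2 => pexpr_eval e1 + pexpr_eval e2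
  | PMul e1 e2 => pexpr_eval e1 * pexpr_eval e2
  | PDiv e1 e2 => pexpr_eval e1 / pexpr_eval e2
  end.

(* Every executed instruction and every loop iteration costs tau, except that
   Entry costs what the evaluator charges for the queried index.  Deciding how
   often to iterate, which involves m, |alpha|_1 and epsilon only, is not
   charged: a bound proportional to |alpha|_1^2/epsilon^2 tends to 0 as epsilon
   grows, so that no program testing epsilon at a positive cost could meet it.  Coef and Pauli are idle when the counter is
   not the index of a term. *)
Fixpoint run (c : prog) (s : state n) : dist (state n) :=
  match c with
  | Draw i =>
      dbind (dunif n) (fun b => dret (tick tau (set_idx s i b)))
  | Pauli k i i' r r' =>
      dret (tick tau
        (if insub (cnt s k) is Some j then
           let ph := pauli_phase R (strings pb j) (idx s i) in
           set_reg (set_reg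
             (set_idx s i' (pauli_target R (strings pb j) (idx s i)))
             r (complex.Re ph)) r' (complex.Im ph)
         else s))
  | Coef k r =>
      dret (tick tau
        (if insub (cnt s k) is Some j then set_reg s r (coefs pb j) else s))
  | Entry i r =>
      dret (tick (entry_cost ev (idx s i))
                 (set_reg s r (entry_value ev (idx s i))))
  | Param r e => dret (tick tau (set_reg s r (pexpr_eval e)))
  | Sign r r1 =>
      dret (tick tau (set_reg s r (sign_at (sign0 pb) (reg s r1))))
  | Arith o r r1 r2 =>
      dret (tick tau (set_reg s r (arith_eval o (reg s r1) (reg s r2))))
  | Seq c1 c2 => dbind (run c1 s) (run c2)
  | For k e c1 =>
      foldl (fun d t => dbind d (fun s' => run c1 (tick tau (set_cnt s' k t))))
            (dret s) (iota 0 (Num.truncn (pexpr_eval e)))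
  end.

Definition outcome (c : prog) : dist (state n) := run c (init_state n).

End Run.

(* The output of a run is the final content of real register 0. *)
Definition output n (s : state n) : R := reg s 0.

Definition computes_entries (n : nat) (delta : R) (v : 'cV[R]_(2 ^ n))
    (ev : evaluator n) : Prop :=
  (forall i, `|entry_value ev i - v i 0| <= delta * `|v i 0|) /\
  (forall i, 0 <= entry_cost ev i).

(* The worst case is over the ensemble as well as over the basis states: the
   supremum of this set depends on the state, not on the matrix drawn. *)
Definition entry_costs (T : Type) (n : nat) (ev : T -> evaluator n) : set R :=
  [set c | exists w i, c = entry_cost (ev w) i].

End Machine.

(* Main.v *)
Require Import Defs.
From HB Require Import structures.
From mathcomp Require Import all_boot all_order all_algebra.
From mathcomp Require Import complex mxtens.
From mathcomp Require Import all_classical all_reals all_analysis.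
From mathcomp Require Import ring lra.

Set Implicit Arguments.
Unset Strict Implicit.
Unset Printing Implicit Defensive.

Import Order.TTheory GRing.Theory Num.Theory.

Local Open Scope classical_set_scope.
Local Open Scope ring_scope.

(* Each Pauli string has one nonzero entry per column, of modulus at most one, so
   with sign vector x the energy density is the mean over a uniform basis state b
   of f(b) = sum_j alpha_j Re(phase_j(b)) x_(target_j(b)) x_b, and |f| <= L with
   L = |alpha|_1.  One sample costs m + 1 entries, and by Chebyshev the average
   of N samples is eps-close to the mean with probability at least
   1 - L^2 / (N eps^2).  Take N = floor(6 u) with u = L^2 / eps^2: either N = 0,
   and then u < 1, so that the initial output 0 is already eps-close to the mean,
   or N >= 6 u / 2 = 3 u. *)

(** * Matrices with at most one nonzero entry per column *)

Section Monomial.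
Variable F : numFieldType.

(** Zero columns are allowed and the modulus is only bounded above; in this form the property passes
    to products, powers and tensor products without any nonvanishing argument. *)
Definition sub_monomial (N : nat) (M : 'M[F]_N) : Prop :=
  forall b, exists a, (forall a', a' != a -> M a' b = 0) /\ `|M a b| <= 1.

Lemma sub_monomial_scale N c (M : 'M[F]_N) :
  `|c| <= 1 -> sub_monomial M -> sub_monomial (c *: M).
Proof.
move=> c1 HM b; have [a [M0 M1]] := HM b; exists a; split=> [a' /M0|].
  by rewrite mxE => ->; rewrite mulr0.
by rewrite mxE normrM mulr_ile1.
Qed.

(** If column [b] of [B] is supported at row [c], then column [b] of the product is column [c] of
    [A] scaled by [B c b]. *)
Lemma sub_monomial_mul N (A B : 'M[F]_N) :
  sub_monomial A -> sub_monomial B -> sub_monomial (A *m B).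
Proof.
move=> HA HB b; have [c [B0 B1]] := HB b; have [a [A0 A1]] := HA c.
have AB a' : (A *m B) a' b = A a' c * B c b.
  by rewrite mxE (bigD1 c)//= big1 ?addr0// => c' /B0 ->; rewrite mulr0.
exists a; split=> [a' /A0|]; rewrite AB; first by move=> ->; rewrite mul0r.
by rewrite normrM mulr_ile1.
Qed.

Lemma sub_monomial1 N : sub_monomial (1%:M : 'M[F]_N).
Proof.
move=> b; exists b; split=> [a /negPf|]; rewrite mxE; first by move=> ->.
by rewrite eqxx normr1.
Qed.

Lemma sub_monomial_exp N (M : 'M[F]_N.+1) k :
  sub_monomial M -> sub_monomial (M ^+ k).
Proof.
move=> HM; elim: k => [|k IH]; first by rewrite expr0 -idmxE; exact: sub_monomial1.
by rewrite exprS; apply: sub_monomial_mul.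
Qed.

Lemma sub_monomial_tens N N' (A : 'M[F]_N) (B : 'M[F]_N') :
  sub_monomial A -> sub_monomial B -> sub_monomial (A *t B).
Proof.
move=> HA HB b; rewrite -(mxtens_unindexK b); case: (mxtens_unindex b) => bA bB.
have [[aA [A0 A1]] [aB [B0 B1]]] := (HA bA, HB bB).
exists (mxtens_index (aA, aB)); split=> [a|]; last first.
  by rewrite tensmxE normrM mulr_ile1.
rewrite -(mxtens_unindexK a); case: (mxtens_unindex a) => cA cB neq.
rewrite tensmxE; have [eA|/A0->] := eqVneq cA aA; last by rewrite mul0r.
have [eB|/B0->] := eqVneq cB aB; last by rewrite mulr0.
by rewrite eA eB eqxx in neq.
Qed.

End Monomial.

(** * Action of Pauli strings on basis states *)

Lemma sub_monomial_tensor_prod (R : realType) n (G : 'I_n -> 'M[R[i]]_2) :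
  (forall j, sub_monomial (G j)) -> sub_monomial (tensor_prod G).
Proof.
elim: n G => [|k IH] G HG /=; first exact: sub_monomial1.
have := sub_monomial_tens (HG ord0) (IH _ (fun j => HG (lift ord0 j))).
(* The cast only renames the dimension, so eliminating the equation turns it into the identity. *)
by case: _ / (esym (expnS 2 k)); rewrite castmx_id.
Qed.

Lemma sub_monomial_pauli (R : realType) n (p : pstring n) :
  sub_monomial (pauli R p).
Proof.
have X1 : sub_monomial (pauliX R).
  move=> b; exists (if b == ord0 then ord_max else ord0).
  split=> [a|]; rewrite mxE; last by rewrite normr_nat; case: (_ != _).
  by case: b => -[|[|?]] ? //; case: a => -[|[|?]].
have Z1 : sub_monomial (pauliZ R).
  move=> b; exists b; split=> [a /negPf|]; rewrite mxE; first by move=> ->.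
  by rewrite eqxx mulr1n normrX normrN1 expr1n.
apply: sub_monomial_tensor_prod => j; apply: sub_monomial_scale.
  by rewrite normrX normCi expr1n.
by apply: sub_monomial_mul; apply: sub_monomial_exp.
Qed.

(* The default value of [pauli_target] is harmless: it is taken only on a zero
   column. *)
Lemma sum_pauli_column (R : realType) n (p : pstring n) (x : 'I_(2 ^ n) -> R) b :
  \sum_a x a * complex.Re (pauli R p a b)
  = x (pauli_target R p b) * complex.Re (pauli_phase R p b).
Proof.
rewrite (bigD1 (pauli_target R p b))//= big1 ?addr0// => a neq.
suff -> : pauli R p a b = 0 by rewrite mulr0.
have [a0 [M0 _]] := sub_monomial_pauli R p b.
(* A nonzero entry at row [a] forces [a = a0]; the row found by [pick] is then [a0] as well, so [a]
   would be the target. *)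
apply/eqP; apply: contraNT neq => Ma; rewrite /pauli_target.
have onea c : pauli R p c b != 0 -> c = a0.
  by move=> nz; apply: contraNeq nz => /M0 ->.
by case: pickP => [c nc|/(_ a)]; [rewrite (onea a)// (onea c)|rewrite Ma].
Qed.

Lemma Re_pauli_phase_le1 (R : realType) n (p : pstring n) b :
  `|complex.Re (pauli_phase R p b)| <= 1.
Proof.
have [a0 [M0 M1]] := sub_monomial_pauli R p b.
suff : `|pauli_phase R p b| <= 1.
  by move/(le_trans (normc_ge_Re _)); rewrite lecE /= => /andP[_].
rewrite /pauli_phase; have [->//|/M0 ->] := eqVneq (pauli_target R p b) a0.
by rewrite normr0.
Qed.

(** * The energy density as a mean over basis states *)

Definition pauli_local_energy (R : realType) n m (alpha : 'I_m -> R)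
    (P : 'I_m -> pstring n) (x : 'I_(2 ^ n) -> R) (b : 'I_(2 ^ n)) : R :=
  \sum_j alpha j * complex.Re (pauli_phase R (P j) b)
         * x (pauli_target R (P j) b) * x b.

Lemma pauli_local_energy_le (R : realType) n m (alpha : 'I_m -> R)
    (P : 'I_m -> pstring n) (x : 'I_(2 ^ n) -> R) b :
  (forall i, `|x i| = 1) ->
  `|pauli_local_energy alpha P x b| <= l1norm alpha.
Proof.
move=> x1; apply: le_trans (ler_norm_sum _ _ _) _; apply: ler_sum => j _.
by rewrite !normrM !x1 !mulr1 ler_piMr// Re_pauli_phase_le1.
Qed.

(** Real parts can be taken term by term because the coefficients are real; after exchanging the
    sums, each column of a string collapses to its target row. *)
Lemma energy_density_pauli (R : realType) n m (alpha : 'I_m -> R)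
    (P : 'I_m -> pstring n) (C : 'M[R]_(2 ^ n)) (x : 'cV[R]_(2 ^ n)) :
  map_mx (real_complex R) C = \sum_j (alpha j)%:C%C *: pauli R (P j) ->
  energy_density C x
  = (2 ^+ n)^-1 * \sum_b pauli_local_energy alpha P (x ^~ 0) b.
Proof.
move=> CE; congr (_ * _).
have CabE a b : C a b = \sum_j alpha j * complex.Re (pauli R (P j) a b).
  have -> : C a b = complex.Re ((map_mx (real_complex R) C) a b) by rewrite mxE.
  rewrite CE summxE; elim/big_rec2: _ => //= j y z _ <-.
  by rewrite mxE; case: z (pauli _ _ _ _) => [? ?] [? ?] /=; ring.
rewrite mxE; apply: eq_bigr => b _; rewrite mxE /pauli_local_energy -mulr_suml.
congr (_ * _); rewrite (eq_bigr (fun a =>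
    \sum_j alpha j * (x a 0 * complex.Re (pauli R (P j) a b)))); last first.
  by move=> a _; rewrite mxE CabE mulr_sumr; apply: eq_bigr => j _; ring.
rewrite exchange_big; apply: eq_bigr => j _.
by rewrite -mulr_sumr (sum_pauli_column _ (x ^~ 0)); ring.
Qed.

(** * Expectations over finitely supported distributions *)

Section Expectation.
Variable R : realType.

Definition expect (A : Type) (d : dist R A) (f : A -> R) : R :=
  \sum_(wa <- d) wa.1 * f wa.2.

Definition weights_ge0 (A : Type) (d : dist R A) : bool :=
  all (fun wa => 0 <= wa.1) d.

Lemma expect_ret (A : Type) (a : A) f : expect (dret R a) f = f a.
Proof. by rewrite /expect big_seq1 mul1r. Qed.

Lemma expect_bind (A B : Type) (d : dist R A) (g : A -> dist R B) f :
  expect (dbind d g) f = expect d (fun a => expect (g a) f).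
Proof.
rewrite /expect big_allpairs_dep; apply: eq_bigr => wa _.
by rewrite mulr_sumr; apply: eq_bigr => wb _; rewrite mulrA.
Qed.

Lemma expect_dunif n (f : 'I_(2 ^ n) -> R) :
  expect (dunif R n) f = (2 ^+ n)^-1 * \sum_b f b.
Proof. by rewrite /expect big_map mulr_sumr big_enum. Qed.

Lemma expect_dunif_cst n (c : R) : expect (dunif R n) (fun=> c) = c.
Proof.
rewrite expect_dunif sumr_const card_ord -[c *+ _]mulr_natl natrX mulrA mulVf ?mul1r//.
Qed.

Lemma expectD (A : Type) (d : dist R A) f g :
  expect d (fun a => f a + g a) = expect d f + expect d g.
Proof. by rewrite /expect -big_split; apply: eq_bigr => wa _; rewrite mulrDr. Qed.

Lemma expectZ (A : Type) (d : dist R A) c f :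
  expect d (fun a => c * f a) = c * expect d f.
Proof. by rewrite /expect mulr_sumr; apply: eq_bigr => wa _; rewrite mulrCA. Qed.

Lemma eq_expect (A : Type) (d : dist R A) f g :
  f =1 g -> expect d f = expect d g.
Proof. by move=> fg; apply: eq_bigr => wa _; rewrite fg. Qed.

Lemma ler_expect (A : Type) (d : dist R A) (I : A -> bool) f g :
  weights_ge0 d -> surely d I -> (forall a, I a -> f a <= g a) ->
  expect d f <= expect d g.
Proof.
rewrite /expect => + + fg; elim: d => [|wa d IH]; first by rewrite !big_nil.
move=> /= /andP[w0 d0] /andP[Ia Id]; rewrite !big_cons lerD ?IH//.
by rewrite ler_wpM2l ?fg.
Qed.

Lemma surely_bind (A B : Type) (d : dist R A) (g : A -> dist R B) E :
  surely (dbind d g) E = surely d (fun a => surely (g a) E).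
Proof.
by rewrite /surely; elim: d => //= wa d IH; rewrite all_cat IH all_map.
Qed.

Lemma weights_ge0_bind (A B : Type) (d : dist R A) (g : A -> dist R B) :
  weights_ge0 d -> (forall a, weights_ge0 (g a)) -> weights_ge0 (dbind d g).
Proof.
move=> + g0; elim: d => //= wa d IH /andP[w0 d0].
rewrite /weights_ge0 all_cat all_map [X in _ && X]IH// andbT.
by apply: sub_all (g0 wa.2) => wb /=; apply: mulr_ge0.
Qed.

Lemma sub_surely (A : Type) (d : dist R A) (I J : A -> bool) :
  (forall a, I a -> J a) -> surely d I -> surely d J.
Proof. by move=> IJ; apply: sub_all => wa /IJ. Qed.

Lemma weights_ge0_dunif n : weights_ge0 (dunif R n).
Proof.
by rewrite /weights_ge0 all_map; apply/allP => b _ /=; rewrite invr_ge0 exprn_ge0.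
Qed.

(** On the sure event [I], the indicator of [G] is at least [1 - g]; taking expectations gives
    Markov's inequality for the failure of [G]. *)
Lemma markov_prob (A : Type) (d : dist R A) (I G : A -> bool) (g : A -> R) :
  weights_ge0 d -> surely d I -> expect d (fun=> 1) = 1 ->
  (forall a, I a -> 0 <= g a) -> (forall a, I a -> ~~ G a -> 1 <= g a) ->
  1 - expect d g <= prob d G.
Proof.
move=> d0 dI d1 g0 g1.
have -> : prob d G = expect d (fun a => (G a)%:R).
  rewrite /prob /expect big_mkcond; apply: eq_bigr => wa _.
  by case: (G _); rewrite ?mulr1 ?mulr0.
have -> : 1 - expect d g = expect d (fun a => 1 + -1 * g a).
  by rewrite expectD expectZ d1 mulN1r.
apply: ler_expect d0 dI _ => a Ia; case: (boolP (G a)) => [_|nG] /=.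
  by have := g0 a Ia; lra.
by have := g1 a Ia nG; lra.
Qed.

End Expectation.

(** * Chains driven by independent uniform indices *)

Section Walk.
Variables (R : realType) (A : Type) (n : nat).
Variable step : nat -> A -> 'I_(2 ^ n) -> A.

(** Abstract form of the sampling loop: all randomness of a step sits in one fresh uniform index, so
    the variance can be bounded independently of the machine. *)
Definition walk (s0 : A) (N : nat) : dist R A :=
  foldl (fun d t => dbind d (fun s =>
           dbind (dunif R n) (fun b => dret R (step t s b))))
        (dret R s0) (iota 0 N).

Lemma walkS s0 N :
  walk s0 N.+1 = dbind (walk s0 N) (fun s =>
    dbind (dunif R n) (fun b => dret R (step N s b))).
Proof. by rewrite /walk -(addn1 N) iotaD foldl_cat add0n. Qed.

Lemma weights_ge0_walk s0 N : weights_ge0 (walk s0 N).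
Proof.
elim: N => [|N IH]; first by rewrite /= /weights_ge0 /= ler01.
rewrite walkS; apply: weights_ge0_bind => // s; apply: weights_ge0_bind.
  exact: weights_ge0_dunif.
by move=> b; rewrite /weights_ge0 /= ler01.
Qed.

Lemma walk_mass s0 N : expect (walk s0 N) (fun=> 1) = 1.
Proof.
elim: N => [|N IH]; first by rewrite expect_ret.
rewrite walkS expect_bind -[RHS]IH; apply: eq_expect => s.
by rewrite expect_bind (@eq_expect _ _ _ _ (fun=> 1)) ?expect_dunif_cst// => b;
  rewrite expect_ret.
Qed.

(** The invariant is indexed by the number of steps, so that it can track a sample count and a clock
    bound growing with it. *)
Lemma surely_walk s0 N (I : nat -> A -> bool) :
  I 0%N s0 -> (forall t s b, I t s -> I t.+1 (step t s b)) ->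
  surely (walk s0 N) (I N).
Proof.
move=> I0 IS; elim: N => [|N IH]; first by rewrite /surely /= I0.
rewrite walkS surely_bind; apply: sub_surely IH => s Is; rewrite surely_bind.
by apply/allP => b _; rewrite /surely /= IS.
Qed.

(* The increments are independent of the past, so their variances add up. *)
Lemma walk_variance (S : A -> R) (f : 'I_(2 ^ n) -> R) (L : R) s0 N :
  S s0 = 0 -> (forall t s b, S (step t s b) = S s + f b) ->
  (forall b, `|f b| <= L) ->
  expect (walk s0 N) (fun s => (S s - N%:R * expect (dunif R n) f) ^+ 2)
  <= N%:R * L ^+ 2.
Proof.
set mu := expect _ f => S0 SS fL; elim: N => [|N IH].
  by rewrite expect_ret S0 !mul0r subr0 expr0n.
rewrite walkS expect_bind.
have f2 : expect (dunif R n) (fun b => f b ^+ 2) <= L ^+ 2.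
  rewrite -[leRHS](expect_dunif_cst n); apply: (@ler_expect _ _ _ predT) => //.
  - exact: weights_ge0_dunif.
  - exact: all_predT.
  move=> b _; rewrite -(ger0_norm (sqr_ge0 (f b))) normrX.
  by rewrite lerXn2r// nnegrE// (le_trans _ (fL b)).
have step_le s : expect (dbind (dunif R n) (fun b => dret R (step N s b)))
    (fun s' => (S s' - N.+1%:R * mu) ^+ 2) <= (S s - N%:R * mu) ^+ 2 + L ^+ 2.
  set c := S s - N%:R * mu.
  rewrite expect_bind (@eq_expect _ _ _ _ (fun b =>
      (c - mu) ^+ 2 + ((2 * (c - mu)) * f b + f b ^+ 2))); last first.
    by move=> b; rewrite expect_ret SS /c -(@natr1 _ N); ring.
  rewrite expectD expectD expect_dunif_cst expectZ -/mu.
  (* Since [f] has mean [mu], the cross term completes the square to [c ^+ 2 - mu ^+ 2]; the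
     negative term is then dropped. *)
  have -> : (c - mu) ^+ 2 + (2 * (c - mu) * mu +
      expect (dunif R n) (fun b => f b ^+ 2))
    = c ^+ 2 - mu ^+ 2 + expect (dunif R n) (fun b => f b ^+ 2) by ring.
  by have := sqr_ge0 mu; lra.
(* The factor 1 displays [L ^+ 2] as a multiple of the constant function 1, whose expectation is the
   total mass. *)
apply: le_trans (_ : expect (walk s0 N) (fun s =>
    (S s - N%:R * mu) ^+ 2 + L ^+ 2 * 1) <= _).
  apply: (@ler_expect _ _ _ predT) => //.
  - exact: weights_ge0_walk.
  - exact: all_predT.
  by move=> s _; rewrite mulr1.
by rewrite expectD expectZ walk_mass -(@natr1 _ N) mulrDl mul1r mulr1 lerD2r.
Qed.

End Walk.

(** * Deterministic programs *)

Section DrawFree.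
Variables (R : realType) (n m : nat) (pb : problem R n m) (ev : evaluator R n).
Variable tau : R.

Fixpoint draw_free (c : prog) : bool :=
  match c with
  | Draw _ => false
  | Seq c1 c2 => draw_free c1 && draw_free c2
  | For _ _ c1 => draw_free c1
  | _ => true
  end.

(* Meaningful for draw-free programs, which have a single outcome. *)
Definition exec_prog (c : prog) (s : state R n) : state R n :=
  (head (0, s) (run pb ev tau c s)).2.

Lemma dret_bind (A B : Type) (a : A) (f : A -> dist R B) :
  dbind (dret R a) f = f a.
Proof.
rewrite /dbind /= cats0; elim: (f a) => //= -[w b] l ->.
by rewrite mul1r.
Qed.

Lemma bind_dretA (A B D : Type) (d : dist R A) (g : A -> B) (f : B -> dist R D) :
  dbind (dbind d (fun a => dret R (g a))) f = dbind d (fun a => f (g a)).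
Proof.
by rewrite /dbind; elim: d => //= wa d ->; rewrite mulr1.
Qed.

(** Only [Draw] branches: loop lengths depend on the problem data and not on the state, so every
    other construct preserves having a single outcome of weight 1. *)
Lemma run_draw_free c s :
  draw_free c -> run pb ev tau c s = dret R (exec_prog c s).
Proof.
move=> dfc; suff [s' Es'] : exists s', run pb ev tau c s = dret R s'.
  by rewrite /exec_prog Es'.
elim: c dfc s => //=; try by move=> *; eexists.
- move=> c1 IH1 c2 IH2 /andP[/IH1{}IH1 /IH2{}IH2] s.
  by have [s1 ->] := IH1 s; have [s2 E2] := IH2 s1; exists s2; rewrite dret_bind.
move=> k e c IH /IH{}IH s; elim: (iota _ _) s => [|t l IHl] s; first by exists s.
by rewrite /= dret_bind; have [s1 ->] := IH (tick tau (set_cnt s k t)); apply: IHl.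
Qed.

Lemma exec_seq c1 c2 s :
  draw_free c1 -> draw_free c2 ->
  exec_prog (Seq c1 c2) s = exec_prog c2 (exec_prog c1 s).
Proof.
by move=> df1 df2; rewrite {1}/exec_prog /= run_draw_free// dret_bind run_draw_free.
Qed.

Lemma exec_for k e c s :
  draw_free c ->
  exec_prog (For k e c) s
  = foldl (fun s' t => exec_prog c (tick tau (set_cnt s' k t))) s
      (iota 0 (Num.truncn (pexpr_eval pb e))).
Proof.
move=> dfc; rewrite {1}/exec_prog /=.
suff -> l s0 : foldl (fun d t => dbind d (fun s' =>
    run pb ev tau c (tick tau (set_cnt s' k t)))) (dret R s0) l
  = dret R (foldl (fun s' t => exec_prog c (tick tau (set_cnt s' k t))) s0 l) by [].
by elim: l s0 => //= t l IH s0; rewrite dret_bind run_draw_free// IH.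
Qed.

(** Gives the body of the sampling loop the shape of one step of [walk]. *)
Lemma run_draw_seq i c s :
  draw_free c ->
  run pb ev tau (Seq (Draw i) c) s
  = dbind (dunif R n) (fun b =>
      dret R (exec_prog c (tick tau (set_idx s i b)))).
Proof.
move=> dfc; rewrite /= bind_dretA; congr (dbind _ _); apply/funext => b.
exact: run_draw_free.
Qed.

Lemma run_for k e c s :
  run pb ev tau (For k e c) s
  = foldl (fun d t => dbind d (fun s' =>
             run pb ev tau c (tick tau (set_cnt s' k t))))
      (dret R s) (iota 0 (Num.truncn (pexpr_eval pb e))).
Proof. by []. Qed.

End DrawFree.

(* Registers: 0 average, 1 sum, 2 number of samples, 3 sign at the drawn basis
   state, 4-7 factors of a term, 8 the constant 1. *)
Definition add_term : prog :=
  Seq (Pauli 1 0 1 4 5) (Seq (Coef 1 6) (Seq (Entry 1 7) (Seq (Sign 7 7)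
  (Seq (Arith Mul 4 4 6) (Seq (Arith Mul 4 4 7) (Seq (Arith Mul 4 4 3)
  (Arith Add 1 1 4))))))).

Definition add_sample : prog :=
  Seq (Entry 0 3) (Seq (Sign 3 3) (Seq (For 1 PTerms add_term)
  (Seq (Param 8 (PNat 1)) (Seq (Arith Add 2 2 8) (Arith Div 0 1 2))))).

(* The average is refreshed inside the loop because, when |alpha|_1 / eps is
   small, the time bound leaves no room for any instruction outside of it. *)
Definition sampler : prog :=
  For 0 (PDiv (PMul (PNat 6) (PMul PNorm PNorm)) (PMul PEps PEps))
    (Seq (Draw 0) add_sample).

(** * Effect and cost of the sampling program *)

Section Sampler.
Variables (R : realType) (n m : nat) (pb : problem R n m) (ev : evaluator R n).
Variables tau E : R.
Hypotheses (tauE : tau <= E) (evE : forall i, entry_cost ev i <= E).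

Local Notation exec := (exec_prog pb ev tau).

(** Computed from the approximate entry; [sign_at_close] later identifies it with the sign of the
    exact one. *)
Definition entry_sign (b : 'I_(2 ^ n)) : R :=
  sign_at (sign0 pb) (entry_value ev b).

Definition sample_term (b : 'I_(2 ^ n)) (j : 'I_m) : R :=
  coefs pb j * complex.Re (pauli_phase R (strings pb j) b)
  * entry_sign (pauli_target R (strings pb j) b) * entry_sign b.

Definition term_loop (s : state R n) (k : nat) : state R n :=
  foldl (fun s' t => exec add_term (tick tau (set_cnt s' 1 t))) s (iota 0 k).

(** The 9 charges are the loop iteration, seven elementary instructions and one [Entry], each at
    most [E]. *)
Lemma exec_add_term s (j : 'I_m) :
  reg s 3 = entry_sign (idx s 0) ->
  let s' := exec add_term (tick tau (set_cnt s 1 j)) in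
  [/\ idx s' 0 = idx s 0, reg s' 3 = reg s 3, reg s' 2 = reg s 2,
      reg s' 1 = reg s 1 + sample_term (idx s 0) j
    & clock s' <= clock s + 9 * E].
Proof.
move=> s3; rewrite /add_term !exec_seq// /exec_prog /= /upd /= !valK /= /upd /=.
split=> //; first by rewrite s3 /sample_term; congr (_ + _); rewrite /entry_sign; ring.
by have := evE (pauli_target R (strings pb j) (idx s 0)); have := tauE; lra.
Qed.

(** The partial sum ranges over natural numbers through [insub], which keeps the induction on [k]
    free of changing ordinal types. *)
Lemma term_loopP s k :
  reg s 3 = entry_sign (idx s 0) -> (k <= m)%N ->
  let s' := term_loop s k in
  [/\ idx s' 0 = idx s 0, reg s' 3 = reg s 3, reg s' 2 = reg s 2,
      reg s' 1 = reg s 1 + \sum_(0 <= t < k)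
        (if insub t is Some j then sample_term (idx s 0) j else 0)
    & clock s' <= clock s + k%:R * (9 * E)].
Proof.
move=> s3; elim: k => [|k IH] km.
  by rewrite /term_loop /= big_geq// addr0 mul0r addr0.
have [i0 r3 r2 r1 ck] := IH (ltnW km).
have -> : term_loop s k.+1
    = exec add_term (tick tau (set_cnt (term_loop s k) 1 (Ordinal km))).
  by rewrite /term_loop -(addn1 k) iotaD foldl_cat add0n.
have s3k : reg (term_loop s k) 3 = entry_sign (idx (term_loop s k) 0).
  by rewrite r3 i0.
cbv zeta; have [-> -> -> -> ck'] := exec_add_term (Ordinal km) s3k.
split=> //; last by have := ck'; rewrite -(@natr1 _ k) mulrDl mul1r; lra.
by rewrite r1 i0 big_nat_recr//= insubT addrA.
Qed.

Definition sample_step (t : nat) (s : state R n) (b : 'I_(2 ^ n)) : state R n :=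
  exec add_sample (tick tau (set_idx (tick tau (set_cnt s 0 t)) 0 b)).

(** Outside the inner loop there are 7 charges: the outer iteration, [Draw], [Entry], [Sign],
    [Param] and two [Arith]. *)
Lemma sample_stepP t s b :
  let s' := sample_step t s b in
  [/\ reg s' 1 = reg s 1 + \sum_j sample_term b j, reg s' 2 = reg s 2 + 1,
      reg s' 0 = reg s' 1 / reg s' 2
    & clock s' <= clock s + (7 * E + m%:R * (9 * E))].
Proof.
rewrite /sample_step /add_sample !exec_seq//= exec_for//=.
rewrite -/(term_loop _ _) natrK; set s0 := exec (Sign 3 3) _.
have s03 : reg s0 3 = entry_sign (idx s0 0) by [].
have [_ _ r2 r1 ck] := term_loopP s03 (leqnn m).
have -> : \sum_j sample_term b j = \sum_(0 <= t < m)
    (if insub t is Some j then sample_term (idx s0 0) j else 0).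
  by rewrite big_mkord; apply: eq_bigr => j _; rewrite valK.
rewrite /upd /= r1 r2; split=> //.
by move: ck; rewrite /s0 /=; have := evE b; have := tauE; lra.
Qed.

Lemma run_sampler s :
  run pb ev tau sampler s
  = walk R sample_step s
      (Num.truncn (6 * (l1norm (coefs pb) * l1norm (coefs pb))
                   / (precision pb * precision pb))).
Proof.
rewrite run_for; congr (foldl _ _ _).
apply/funext => d; apply/funext => t; congr (dbind d _); apply/funext => s'.
exact: run_draw_seq.
Qed.

End Sampler.

(** * Signs from approximate entries, and the final bounds *)

(** A relative error below 1 cannot reach 0 from a nonzero [v]; for [v = 0] it forces [u = 0], so
    the convention for sign(0) agrees too. *)
Lemma sign_at_close (R : realType) (s : bool) (delta u v : R) :
  delta < 1 -> `|u - v| <= delta * `|v| -> sign_at s u = sign_at s v.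
Proof.
move=> d1 uv; rewrite /sign_at.
have [v0|v0|v0] := ltgtP v 0.
- rewrite (ltr0_norm v0) in uv; have /ltr_normlP[_ ?] : `|u - v| < - v by nra.
  have u0 : u < 0 by lra.
  by rewrite lt_eqF// !ltr0_sg.
- rewrite (gtr0_norm v0) in uv; have /ltr_normlP[? _] : `|u - v| < v by nra.
  have u0 : 0 < u by lra.
  by rewrite gt_eqF// !gtr0_sg.
by move: uv; rewrite v0 normr0 mulr0 subr0 normr_le0 => /eqP ->; rewrite eqxx.
Qed.

Lemma normr_sign_at (R : realType) (s : bool) (v : R) : `|sign_at s v| = 1.
Proof.
rewrite /sign_at; have [_|v0] := eqVneq v 0; first by rewrite normrX normrN1 expr1n.
by rewrite normr_sg v0.
Qed.

Theorem proposition30 (R : realType) :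
  exists (p : prog) (K : R),
  forall (m : nat -> nat), poly_bounded m ->
  forall (n : nat) (alpha : 'I_(m n) -> R) (P : 'I_(m n) -> pstring n)
    (C : 'M[R]_(2 ^ n)),
  C \is symmetricmx ->
  map_mx (real_complex R) C = \sum_j (alpha j)%:C%C *: pauli R (P j) ->
  forall rho sqrt_rho : 'M[R]_(2 ^ n),
  quantum_state rho -> psd_sqrt sqrt_rho rho ->
  forall (d : measure_display) (T : measurableType d) (mu : probability T R)
    (U : T -> 'M[R]_(2 ^ n)),
  random_orthogonal U ->
  forall (delta : R) (ev : T -> evaluator R n),
  0 <= delta < 1 ->
  (forall w, computes_entries delta (sqrt_rho *m U w *m ket0 R n) (ev w)) ->
  has_ubound (entry_costs ev) ->
  let E := sup (entry_costs ev) in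
  forall tau : R, 0 <= tau <= E ->
  forall (s : bool) (eps : R), 0 < eps ->
  forall w : T,
  let x := sign_vec s (sqrt_rho *m U w *m ket0 R n) in
  let runs := outcome (Problem alpha P eps s) (ev w) tau p in
  surely runs (fun st =>
    clock st <= K * (eps ^- 2 * (m n)%:R * E * l1norm alpha ^+ 2)) /\
  2 / 3 <= prob runs (fun st => `|output st - energy_density C x| <= eps).
Proof.
(* 96 = 6 * 16: at most [6 * u] samples, each of cost at most [16 * (m n)%:R * E] when there is a
   term. *)
exists sampler, 96 => m _ n alpha P C _ CE rho sr _ _ d T _ U _ delta ev.
move=> /andP[_ delta1] evP Eub E tau /andP[tau0 tauE] s eps eps0 w x runs.
pose pb := Problem alpha P eps s.
set L := l1norm alpha.
have evE i : entry_cost (ev w) i <= E by apply: ub_le_sup => //; exists w, i.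
have E0 : 0 <= E by apply: le_trans tauE.
have L0 : 0 <= L by apply: sumr_ge0.
have signE b : entry_sign pb (ev w) b = x b 0.
  by rewrite mxE; apply: sign_at_close delta1 ((evP w).1 b).
pose f b := \sum_j sample_term pb (ev w) b j.
have fE b : f b = pauli_local_energy alpha P (x ^~ 0) b.
  by apply: eq_bigr => j _; rewrite /sample_term !signE.
have fL b : `|f b| <= L.
  by rewrite fE pauli_local_energy_le// => i; rewrite mxE normr_sign_at.
set e := energy_density C x.
have meanE : expect (dunif R n) f = e.
  rewrite expect_dunif /e (energy_density_pauli _ CE).
  by congr (_ * _); apply: eq_bigr => b _; exact: fE.
have eL : `|e| <= L.
  rewrite ler_norml -meanE -{2}(expect_dunif_cst n L).
  rewrite -[X in X <= _](expect_dunif_cst n (- L)).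
  by apply/andP; split; apply: (@ler_expect _ _ _ predT) => //;
    rewrite ?weights_ge0_dunif// ?[surely _ _]all_predT// => b _;
    have := fL b; rewrite ler_norml => /andP[].
(* Introduced opaquely, so that the arithmetic tactics see [u] as a variable and [Lu] replaces the
   division. *)
have [u uE] : exists u, u = L ^+ 2 / eps ^+ 2 by eexists.
have u0 : 0 <= u by rewrite uE divr_ge0 ?sqr_ge0.
have Lu : L ^+ 2 = u * eps ^+ 2 by rewrite uE divfK// expf_neq0 ?gt_eqF.
set N := Num.truncn (6 * u).
have /andP[Nle Ngt] : N%:R <= 6 * u < N.+1%:R by rewrite truncn_itv// mulr_ge0.
have runsE : runs
    = walk R (sample_step pb (ev w) tau) (init_state R n) N.
  by rewrite /runs /outcome run_sampler /= -/L -!expr2 -mulrA -uE.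
set W := walk _ _ _ _ in runsE.
pose c := 7 * E + (m n)%:R * (9 * E).
(* At [k = 0] the clause on register 0 reads 0 = 0 / 0, true of the initial state since this
   quotient is 0. *)
pose I k (st : state R n) := [&& reg st 2 == k%:R, reg st 0 == reg st 1 / k%:R
  & clock st <= k%:R * c].
have IW : surely W (I N).
  apply: (@surely_walk R _ n _ _ N I) => [|t st b /and3P[/eqP r2 _ ck]].
    by rewrite /I /= eqxx mul0r eqxx mul0r lexx.
  have [_ r2' r0' ck'] := sample_stepP pb tauE evE t st b.
  rewrite /I r0' r2' r2 natr1 !eqxx /=; apply: le_trans ck' _.
  by rewrite -/c -(@natr1 _ t) mulrDl mul1r lerD2r.
rewrite runsE; split.
  apply: sub_surely IW => st /and3P[_ _ /le_trans]; apply.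
  rewrite (_ : _ * _ * E * _ = u * ((m n)%:R * E)); last by rewrite uE; ring.
  (* Without terms the time allowed is 0, while a sample still pays for its own overhead; but then
     [L = 0], so no sample is drawn. *)
  have [m0|m0] := posnP (m n).
    have L00 : L = 0 by rewrite /L /l1norm big1// => j; have := ltn_ord j; rewrite {2}m0.
    have Ni0 : N%:R <= 0 :> R by rewrite (le_trans Nle)// uE L00 expr0n mul0r mulr0.
    have -> : N%:R = 0 :> R by apply/eqP; rewrite eq_le Ni0 ler0n.
    by rewrite m0 !mul0r !mulr0.
  have cE : c <= 16 * ((m n)%:R * E).
    have : 1 * E <= (m n)%:R * E by rewrite ler_wpM2r// ler1n.
    by rewrite /c; lra.
  rewrite (_ : 96 * _ = (6 * u) * (16 * ((m n)%:R * E))); last by ring.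
  by apply: ler_pM => //; rewrite addr_ge0 ?mulr_ge0.
have [N0|N0] := posnP N.
  have Leps : L <= eps.
    rewrite -(@ler_pXn2r _ 2) ?nnegrE ?(ltW eps0)// Lu ler_piMl ?sqr_ge0//.
    by move: Ngt; rewrite N0; lra.
  rewrite /W N0 /prob big_mkcond big_seq1 /= sub0r normrN.
  by rewrite (le_trans eL Leps); lra.
have NR : 0 < N%:R :> R by rewrite ltr0n.
(* Chebyshev's test function: the squared deviation of the sum, scaled to be at least 1 once the
   average is off by more than [eps]. *)
pose dev (st : state R n) := (N%:R * eps) ^- 2 * (reg st 1 - N%:R * e) ^+ 2.
apply: le_trans (_ : 1 - expect W dev <= _); last first.
  apply: markov_prob IW _ _ _ => [|| st _|st /and3P[_ /eqP r0 _]].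
  - exact: weights_ge0_walk.
  - exact: walk_mass.
  - by rewrite mulr_ge0 ?invr_ge0 ?sqr_ge0.
  rewrite /output r0 -ltNge => far; rewrite /dev mulrC ler_pdivlMr ?exprn_gt0 ?mulr_gt0//.
  rewrite mul1r -[leRHS]real_normK ?num_real// lerXn2r ?nnegrE ?mulr_ge0// ?(ltW eps0)//.
  rewrite (_ : _ - _ = N%:R * (reg st 1 / N%:R - e)).
    by rewrite normrM ger0_norm// ler_pM2l// ltW.
  by rewrite mulrBr [X in _ = X - _]mulrCA divff ?mulr1// gt_eqF.
(* The variance bound is [N%:R * u * eps ^+ 2], and [6 * u < N.+1%:R <= 2 * N%:R] gives
   [u <= N%:R / 3]. *)
have : expect W dev <= 1 / 3.
  rewrite expectZ ler_pdivrMl ?exprn_gt0 ?mulr_gt0//.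
  have := @walk_variance R _ n (sample_step pb (ev w) tau) (fun st => reg st 1)
    f L (init_state R n) N erefl _ fL.
  rewrite meanE => /(_ _) /le_trans; apply.
    by move=> t st b; have [-> _ _ _] := sample_stepP pb tauE evE t st b.
  rewrite Lu (_ : N%:R * _ = N%:R * eps ^+ 2 * u); last by ring.
  rewrite (_ : _ ^+ 2 * _ = N%:R * eps ^+ 2 * (N%:R / 3)); last by field.
  rewrite ler_pM2l ?mulr_gt0 ?exprn_gt0//.
  have : 1 <= N%:R :> R by rewrite ler1n.
  by move: Ngt; rewrite -(@natr1 _ N); lra.
by lra.
Qed.
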